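(* Consider the setting in the context with $P_i=\tau_iI_n$, $Q_i=\zeta_iI_n$ ($\tau_i,\zeta_i>0$), $\rho>0$, and assume (P1) admits a KKT point. If there exist $\gamma\in(0,2)$ and $\epsilon_i\in(0,1)$, $i\in\mathcal{V}$, such that $$\tau_i>\rho\Big(\frac1{\epsilon_i}-1\Big)d_i,\qquad \zeta_i>\frac{C_i}{m}(C_i+m),\qquad \sum_{i}\epsilon_i<2-\gamma,$$ then the sequence $\bm{u}^k=(\check{\bm{W}}^k,\hat{\bm{W}}^k,\lambda^k)$ generated by the algorithm (with step parameter $\gamma$) converges to an optimal primal–dual (KKT) solution $\bm{u}^*$ of (P1).
   Context: Let $\mathcal{G}=(\mathcal{V},\mathcal{E})$ be a connected undirected graph with $\mathcal{V}=\{1,\dots,N\}$, $N\ge 2$, and let $d_i$ be the degree of $i$. Variables are $\check{\bm{w}}_i,\hat{\bm{w}}_i\in\mathbb{R}^n$; write $\check{\bm{W}}=(\check{\bm{w}}_1,\dots,\check{\bm{w}}_N)$, $\hat{\bm{W}}$ likewise, $\bm{z}_i=(\check{\bm{w}}_i,\hat{\bm{w}}_i)$, $\bm{Z}=(\check{\bm{W}},\hat{\bm{W}})$. The matrix $\bm{A}\in\mathbb{R}^{|\mathcal{E}|n\times Nn}$ has one block row per edge $\{i,j\}$ ($i<j$) with $I_n$ in block column $i$, $-I_n$ in block column $j$, zeros elsewhere; $A_i$ is its $i$-th block column, so $\bm{A}\check{\bm{W}}=\sum_iA_i\check{\bm{w}}_i$ and $A_i^TA_i=d_iI_n$. Each $f_i:\mathbb{R}^n\times\mathbb{R}^n\to\mathbb{R}$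 is differentiable, jointly convex, with $\nabla f_i$ Lipschitz with constant $C_i$. Let $\mu_1\ge0$, $\mu_2>0$, $F_i(\bm{z}_i)=f_i(\check{\bm{w}}_i,\hat{\bm{w}}_i)+\frac{\mu_1}{2}\|\check{\bm{w}}_i\|^2+\frac{\mu_2}{2}\|\hat{\bm{w}}_i\|^2$, $\bm{F}(\bm{Z})=\sum_iF_i(\bm{z}_i)$, and let $m$ be a constant with $0<m\le\mu_2$. Problem (P1): minimize $\bm{F}(\bm{Z})$ s.t. $\bm{A}\check{\bm{W}}=0$; a KKT point is $(\check{\bm{W}}^*,\hat{\bm{W}}^*,\lambda^* )$ with $\bm{A}\check{\bm{W}}^*=0$, $A_i^T\lambda^*=\nabla_{\check{\bm{w}}_i}F_i(\bm{z}_i^* )$, $\nabla_{\hat{\bm{w}}_i}F_i(\bm{z}_i^* )=0$. Algorithm: with $\mathcal{L}_\rho=\bm{F}(\bm{Z})-\lambda^T\bm{A}\check{\bm{W}}+\frac\rho2\|\bm{A}\check{\bm{W}}\|^2$, from arbitrary $\check{\bm{W}}^0,\hat{\bm{W}}^0,\lambda^0$, for $k=0,1,\dots$: (i) for all $i$ in parallel $\check{\bm{w}}_i^{k+1}=\arg\min_{\check{\bm{w}}_i}\mathcal{L}_\rho(\check{\bm{w}}_i,\check{\bm{W}}^k_{-i},\hat{\bm{W}}^k,\lambda^k)+\frac12\|\check{\bm{w}}_i-\check{\bm{w}}_i^k\|^2_{P_i}$ (other blocks held at iteration $k$); (ii) $\lambda^{k+1}=\lambda^k-\gamma\rho\bm{A}\check{\bm{W}}^{k+1}$;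 (iii) for all $i$ in parallel $\hat{\bm{w}}_i^{k+1}=\arg\min_{\hat{\bm{w}}_i}F_i(\check{\bm{w}}_i^{k+1},\hat{\bm{w}}_i)+\frac12\|\hat{\bm{w}}_i-\hat{\bm{w}}_i^k\|^2_{Q_i}$. Here $\|x\|^2_S=x^TSx$. *)

(* Defs.v *)
From HB Require Import structures.
From mathcomp Require Import all_boot all_order all_algebra.
From mathcomp Require Import all_classical all_reals all_analysis.
Set Implicit Arguments.
Unset Strict Implicit.
Unset Printing Implicit Defensive.
Import Order.TTheory GRing.Theory Num.Theory.
Local Open Scope ring_scope.

Definition dotv (R : pzRingType) (n : nat) (u v : 'rV[R]_n) : R :=
  \sum_(j < n) u ord0 j * v ord0 j.
Definition nsq (R : pzRingType) (n : nat) (u : 'rV[R]_n) : R := dotv u u.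

(* Graph on V = {0,...,N-1}: a symmetric irreflexive relation adj.
   Edges {i,j} are represented once, as pairs (i,j) with i < j. *)
Definition edge (N : nat) (adj : rel 'I_N) : Type :=
  {e : 'I_N * 'I_N | ((nat_of_ord e.1 < nat_of_ord e.2)%N && adj e.1 e.2)}.
HB.instance Definition _ (N : nat) (adj : rel 'I_N) :=
  Finite.copy (edge adj)
   {e : 'I_N * 'I_N | ((nat_of_ord e.1 < nat_of_ord e.2)%N && adj e.1 e.2)}.

Definition etail N (adj : rel 'I_N) (e : edge adj) : 'I_N := (sval e).1.
Definition ehead N (adj : rel 'I_N) (e : edge adj) : 'I_N := (sval e).2.

Definition graph_connected N (adj : rel 'I_N) : Prop :=
  forall i j : 'I_N, connect adj i j.

Definition deg (R : pzRingType) N (adj : rel 'I_N) (i : 'I_N) : R :=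
  (#|[pred j | adj i j]|)%:R.

Definition Aop (R : pzRingType) n N (adj : rel 'I_N) (W : 'I_N -> 'rV[R]_n)
  (e : edge adj) : 'rV[R]_n := W (etail e) - W (ehead e).

Definition AiT (R : pzRingType) n N (adj : rel 'I_N) (lam : edge adj -> 'rV[R]_n)
  (i : 'I_N) : 'rV[R]_n :=
  \sum_(e : edge adj | etail e == i) lam e - \sum_(e : edge adj | ehead e == i) lam e.

Definition jconvex (R : realType) n (g : 'rV[R]_n * 'rV[R]_n -> R) : Prop :=
  forall (x y : 'rV[R]_n * 'rV[R]_n) (t : R), 0 <= t <= 1 ->
    g (t *: x.1 + (1 - t) *: y.1, t *: x.2 + (1 - t) *: y.2)
      <= t * g x + (1 - t) * g y.

Definition has_gradient (R : realType) n (g : 'rV[R]_n * 'rV[R]_n -> R)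
  (gc gh : 'rV[R]_n * 'rV[R]_n -> 'rV[R]_n) : Prop :=
  forall z, differentiable g z /\
    forall h : 'rV[R]_n * 'rV[R]_n, 'd g z h = dotv (gc z) h.1 + dotv (gh z) h.2.

Definition lipschitz_grad (R : realType) n (gc gh : 'rV[R]_n * 'rV[R]_n -> 'rV[R]_n)
  (C : R) : Prop :=
  forall z z' : 'rV[R]_n * 'rV[R]_n,
    Num.sqrt (nsq (gc z - gc z') + nsq (gh z - gh z'))
      <= C * Num.sqrt (nsq (z.1 - z'.1) + nsq (z.2 - z'.2)).

Definition Fi (R : realType) n (g : 'rV[R]_n * 'rV[R]_n -> R) (mu1 mu2 : R)
  (wc wh : 'rV[R]_n) : R :=
  g (wc, wh) + mu1 / 2 * nsq wc + mu2 / 2 * nsq wh.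

Definition Ftot (R : realType) n N (f : 'I_N -> 'rV[R]_n * 'rV[R]_n -> R)
  (mu1 mu2 : R) (Wc Wh : 'I_N -> 'rV[R]_n) : R :=
  \sum_i Fi (f i) mu1 mu2 (Wc i) (Wh i).

Definition Lrho (R : realType) n N (adj : rel 'I_N)
  (f : 'I_N -> 'rV[R]_n * 'rV[R]_n -> R) (mu1 mu2 rho : R)
  (Wc Wh : 'I_N -> 'rV[R]_n) (lam : edge adj -> 'rV[R]_n) : R :=
  Ftot f mu1 mu2 Wc Wh - \sum_(e : edge adj) dotv (lam e) (Aop Wc e)
  + rho / 2 * \sum_(e : edge adj) nsq (Aop Wc e).

(* KKT point of (P1); the gradient of F_i is
   (gc_i z + mu1 wc, gh_i z + mu2 wh). *)
Definition KKT (R : realType) n N (adj : rel 'I_N)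
  (gc gh : 'I_N -> 'rV[R]_n * 'rV[R]_n -> 'rV[R]_n) (mu1 mu2 : R)
  (Wc Wh : 'I_N -> 'rV[R]_n) (lam : edge adj -> 'rV[R]_n) : Prop :=
  (forall e : edge adj, Aop Wc e = 0) /\
  (forall i, AiT lam i = gc i (Wc i, Wh i) + mu1 *: Wc i) /\
  (forall i, gh i (Wc i, Wh i) + mu2 *: Wh i = 0).

Definition P1_optimal (R : realType) n N (adj : rel 'I_N)
  (f : 'I_N -> 'rV[R]_n * 'rV[R]_n -> R) (mu1 mu2 : R)
  (Wc Wh : 'I_N -> 'rV[R]_n) : Prop :=
  (forall e : edge adj, Aop Wc e = 0) /\
  forall Wc' Wh' : 'I_N -> 'rV[R]_n, (forall e : edge adj, Aop Wc' e = 0) ->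
    Ftot f mu1 mu2 Wc Wh <= Ftot f mu1 mu2 Wc' Wh'.

Definition upd (R : Type) N (W : 'I_N -> R) (i : 'I_N) (w : R) : 'I_N -> R :=
  fun j => if j == i then w else W j.

(* One iteration k -> k+1 of the algorithm, with P_i = tau_i I_n, Q_i = zeta_i I_n:
   the new blocks are (the) minimizers of the stated subproblems. *)
Definition alg_step (R : realType) n N (adj : rel 'I_N)
  (f : 'I_N -> 'rV[R]_n * 'rV[R]_n -> R) (mu1 mu2 rho gamma : R)
  (tau zeta : 'I_N -> R)
  (Wc Wh : nat -> 'I_N -> 'rV[R]_n) (lam : nat -> edge adj -> 'rV[R]_n)
  (k : nat) : Prop :=
  (forall i (w : 'rV[R]_n),
     Lrho f mu1 mu2 rho (upd (Wc k) i (Wc k.+1 i)) (Wh k) (lam k)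
       + 1 / 2 * (tau i * nsq (Wc k.+1 i - Wc k i))
     <= Lrho f mu1 mu2 rho (upd (Wc k) i w) (Wh k) (lam k)
       + 1 / 2 * (tau i * nsq (w - Wc k i))) /\
  (forall e : edge adj, lam k.+1 e = lam k e - (gamma * rho) *: Aop (Wc k.+1) e) /\
  (forall i (w : 'rV[R]_n),
     Fi (f i) mu1 mu2 (Wc k.+1 i) (Wh k.+1 i)
       + 1 / 2 * (zeta i * nsq (Wh k.+1 i - Wh k i))
     <= Fi (f i) mu1 mu2 (Wc k.+1 i) w + 1 / 2 * (zeta i * nsq (w - Wh k i))).

(* Main.v *)
(** Write [x, y, l] for the iterates [Wc, Wh, lam].  For every KKT point
    [(xs, ys, ls)] the function
      V = |l - ls|^2 / (2 gamma rho)
          + sum_i ((tau_i + rho d_i) / 2 |x_i - xs_i|^2 + zeta_i / 2 |y_i - ys_i|^2)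
    decreases at each iteration by at least a positive combination of
    [|A x+|^2], [|x+ - x|^2] and [|y+ - y|^2].  The dual and the x-terms follow
    the usual proximal Jacobi ADMM estimate, Young's inequality with weights
    [eps_i] absorbing the cross term [rho <A (x+ - x), A x+>].  Since the
    x-gradient is taken at the mixed point [(x+, y)], convexity is used there,
    and the descent lemma in [y] together with the strong convexity [m] costs
    exactly [C_i / m (C_i + m)].

    The iterates are therefore bounded.  Along an ultrafilter finer than [\oo]
    they all converge; as the successive differences vanish, the limit is a KKT
    point.  V relative to this limit is nonincreasing and tends to 0 along the
    ultrafilter, hence along [\oo]. *)

Require Import Defs.
From HB Require Import structures.
From mathcomp Require Import all_boot all_order all_algebra.
From mathcomp Require Import all_classical all_reals all_analysis.
From mathcomp Require Import ring lra.
Import Order.TTheory GRing.Theory Num.Theory.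
Import numFieldNormedType.Exports.
Local Open Scope classical_set_scope.
Local Open Scope ring_scope.

Set Implicit Arguments.
Unset Strict Implicit.
Unset Printing Implicit Defensive.

(** * Inner products and incidence operators *)

Section DotProduct.
Variables (R : comPzRingType) (n : nat).
Implicit Types (u v w : 'rV[R]_n) (a : R).

Lemma dotvC u v : dotv u v = dotv v u.
Proof. by apply: eq_bigr => j _; rewrite mulrC. Qed.

Lemma dotvDl u v w : dotv (u + v) w = dotv u w + dotv v w.
Proof. by rewrite -big_split; apply: eq_bigr => j _; rewrite mxE mulrDl. Qed.

Lemma dotvZl a u w : dotv (a *: u) w = a * dotv u w.
Proof. by rewrite mulr_sumr; apply: eq_bigr => j _; rewrite mxE mulrA. Qed.

Lemma dotvNl u w : dotv (- u) w = - dotv u w.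
Proof. by rewrite -scaleN1r dotvZl mulN1r. Qed.

Lemma dotvBl u v w : dotv (u - v) w = dotv u w - dotv v w.
Proof. by rewrite dotvDl dotvNl. Qed.

Lemma dotvDr w u v : dotv w (u + v) = dotv w u + dotv w v.
Proof. by rewrite dotvC dotvDl !(dotvC _ w). Qed.

Lemma dotvZr a w u : dotv w (a *: u) = a * dotv w u.
Proof. by rewrite dotvC dotvZl dotvC. Qed.

Lemma dotvNr w u : dotv w (- u) = - dotv w u.
Proof. by rewrite dotvC dotvNl dotvC. Qed.

Lemma dotvBr w u v : dotv w (u - v) = dotv w u - dotv w v.
Proof. by rewrite dotvDr dotvNr. Qed.

Lemma dot0v w : dotv 0 w = 0.
Proof. by apply: big1 => j _; rewrite mxE mul0r. Qed.

Lemma dotv0 w : dotv w 0 = 0.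
Proof. by rewrite dotvC dot0v. Qed.

Lemma dotv_suml (I : Type) (r : seq I) (P : pred I) (F : I -> 'rV[R]_n) w :
  dotv (\sum_(i <- r | P i) F i) w = \sum_(i <- r | P i) dotv (F i) w.
Proof.
by elim/big_rec2: _ => [|i x y _ <-]; rewrite ?dot0v ?dotvDl.
Qed.

Lemma nsqN u : nsq (- u) = nsq u.
Proof. by rewrite /nsq dotvNl dotvNr opprK. Qed.

Lemma nsqZ a u : nsq (a *: u) = a ^+ 2 * nsq u.
Proof. by rewrite /nsq dotvZl dotvZr mulrA. Qed.

Lemma nsqD u v : nsq (u + v) = nsq u + 2 * dotv u v + nsq v.
Proof. by rewrite /nsq dotvDl !dotvDr (dotvC v u); ring. Qed.

Lemma nsqB u v : nsq (u - v) = nsq (v - u).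
Proof. by rewrite -opprB nsqN. Qed.

End DotProduct.

Definition dotvE :=
  (dotvDl, dotvDr, dotvNl, dotvNr, dotvZl, dotvZr, dot0v, dotv0).

Section NormSquare.
Variables (R : realType) (n : nat).
Implicit Types (u v : 'rV[R]_n) (a c : R).

Lemma nsq_ge0 u : 0 <= nsq u.
Proof. by apply: sumr_ge0 => j _; rewrite -expr2 sqr_ge0. Qed.

Lemma nsq_le0_eq0 u : nsq u <= 0 -> u = 0.
Proof.
move=> u0; have /eqP : nsq u = 0 by apply/eqP; rewrite eq_le u0 nsq_ge0.
rewrite psumr_eq0; last by move=> j _; rewrite -expr2 sqr_ge0.
move=> /allP h; apply/rowP => j; rewrite mxE.
have /= := h j (mem_index_enum j).
by rewrite mulf_eq0 orbb => /eqP.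
Qed.

Lemma dotv_eq0 u : (forall v, dotv u v = 0) -> u = 0.
Proof. by move=> /(_ u) u0; apply: nsq_le0_eq0; rewrite /nsq u0. Qed.

(** Expand [|a u - v|^2 >= 0] and divide by [2 a]. *)
Lemma young a u v : 0 < a -> dotv u v <= a / 2 * nsq u + (2 * a)^-1 * nsq v.
Proof.
move=> a0; have := nsq_ge0 (a *: u - v).
rewrite /nsq !dotvE (dotvC v u) => h.
rewrite -(ler_pM2l a0) mulrDr.
have -> : a * (a / 2 * dotv u u) + a * ((2 * a)^-1 * dotv v v) =
  a * a / 2 * dotv u u + 2^-1 * dotv v v by field; rewrite gt_eqF.
lra.
Qed.

(** A root-free Cauchy-Schwarz: Young's inequality with weight [1 / c]. For [c = 0] the hypothesis
    forces [u = 0]. *)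
Lemma dotv_le_nsq c u v : 0 <= c -> nsq u <= c ^+ 2 * nsq v -> dotv u v <= c * nsq v.
Proof.
rewrite le_eqVlt => /predU1P[<-|c0 h].
  by rewrite expr0n /= mul0r => /nsq_le0_eq0 ->; rewrite dot0v.
have := @young c^-1 u v; rewrite invr_gt0 => /(_ c0)/le_trans; apply.
have : c^-1 / 2 * nsq u <= c^-1 / 2 * (c ^+ 2 * nsq v).
  by rewrite ler_pM2l // divr_gt0 ?invr_gt0.
have -> : c^-1 / 2 * (c ^+ 2 * nsq v) = c / 2 * nsq v by field; rewrite gt_eqF.
have -> : (2 / c)^-1 * nsq v = c / 2 * nsq v by field; rewrite gt_eqF.
lra.
Qed.

End NormSquare.

(** * Edge space, incidence operator and its adjoint *)

Section Incidence.
Variables (R : comPzRingType) (n N : nat) (adj : rel 'I_N).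
Implicit Types (W : 'I_N -> 'rV[R]_n) (lam mu : edge adj -> 'rV[R]_n).

Definition dotE lam mu : R := \sum_e dotv (lam e) (mu e).

(** The family supported at node [i], so that [Aop (blk i v)] is [A_i v]. *)
Definition blk i (v : 'rV[R]_n) : 'I_N -> 'rV[R]_n := upd (fun=> 0) i v.

Lemma AiTD lam mu i : AiT (fun e => lam e + mu e) i = AiT lam i + AiT mu i.
Proof. by rewrite /AiT !big_split /= opprD addrACA. Qed.

Lemma AiTZ a lam i : AiT (fun e => a *: lam e) i = a *: AiT lam i.
Proof. by rewrite /AiT -!scaler_sumr scalerBr. Qed.

Lemma AopB W W' (e : edge adj) :
  Aop (fun i => W i - W' i) e = Aop W e - Aop W' e.
Proof. by rewrite /Aop !opprD addrACA. Qed.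

(** Adjointness of [A] and the family [A_i^T]: the sum over edges is regrouped once by tails and
    once by heads. *)
Lemma dotE_Aop lam W : dotE lam (Aop W) = \sum_i dotv (AiT lam i) (W i).
Proof.
have node (end_ : edge adj -> 'I_N) : \sum_e dotv (lam e) (W (end_ e)) =
    \sum_i dotv (\sum_(e | end_ e == i) lam e) (W i).
  rewrite (partition_big end_ xpredT) //=; apply: eq_bigr => i _.
  by rewrite dotv_suml; apply: eq_bigr => e /eqP ->.
rewrite /dotE; under eq_bigr do rewrite dotvBr.
rewrite sumrB !node -sumrB; apply: eq_bigr => i _.
by rewrite -dotvBl.
Qed.

Lemma sum_blk i v (F : 'I_N -> 'rV[R]_n -> R) : (forall j, F j 0 = 0) ->
  \sum_j F j (blk i v j) = F i v.
Proof.
move=> F0; rewrite (bigD1 i) //= /blk /upd eqxx big1 ?addr0 // => j /negPf ->.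
exact: F0.
Qed.

Lemma dotE_Aop_blk lam i v : dotE lam (Aop (blk i v)) = dotv (AiT lam i) v.
Proof.
by rewrite dotE_Aop (sum_blk i v (F := fun j => dotv (AiT lam j))) // => j; rewrite dotv0.
Qed.

Hypotheses (adjC : symmetric adj) (adjI : irreflexive adj).

Lemma sum_edge (F : 'I_N * 'I_N -> R) :
  \sum_(e : edge adj) F (val e) =
  \sum_a \sum_(b | (nat_of_ord a < nat_of_ord b)%N && adj a b) F (a, b).
Proof.
rewrite pair_big_dep /=.
rewrite -(big_sub (fun e : 'I_N * 'I_N => (nat_of_ord e.1 < nat_of_ord e.2)%N && adj e.1 e.2)).
by apply: eq_bigr => -[].
Qed.

(** Each neighbour [j] of [i] gives one edge at [i]: with tail [i] if [i < j], with head [i] if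
    [j < i]. *)
Lemma deg_edges i :
  deg R adj i = (\sum_(e : edge adj | etail e == i) 1) + \sum_(e : edge adj | ehead e == i) 1.
Proof.
rewrite [X in _ = X + _]big_mkcond [X in _ = _ + X]big_mkcond.
rewrite (sum_edge (fun p => if p.1 == i then 1 else 0)).
rewrite (sum_edge (fun p => if p.2 == i then 1 else 0)) /=.
have -> : \sum_a \sum_(b | (nat_of_ord a < nat_of_ord b)%N && adj a b) (if a == i then 1 else 0) =
  \sum_(b | (nat_of_ord i < nat_of_ord b)%N && adj i b) 1 :> R.
  rewrite (bigD1 i) //= eqxx [X in _ + X]big1 ?addr0 // => a /negPf ->.
  by rewrite big1.
have -> : \sum_a \sum_(b | (nat_of_ord a < nat_of_ord b)%N && adj a b) (if b == i then 1 else 0) =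
  \sum_(a | (nat_of_ord a < nat_of_ord i)%N && adj i a) 1 :> R.
  rewrite (exchange_big_dep xpredT) //= (bigD1 i) //= eqxx [X in _ + X]big1 ?addr0; last first.
    by move=> a /negPf ->; rewrite big1.
  by apply: eq_bigl => a; rewrite adjC.
rewrite /deg -sum1_card natr_sum /= (bigID (fun b : 'I_N => (i < b)%N)) /=.
congr (_ + _); apply: eq_bigl => j; rewrite unfold_in /= andbC //.
by rewrite -leqNgt ltn_neqAle; case: eqVneq => //= [/val_inj ->]; rewrite adjI andbF.
Qed.

(** The identity [A_i^T A_i = d_i I]: an edge with tail [i] contributes [v], one with head [i]
    contributes [- (- v)], and no edge is a loop. *)
Lemma AiT_Aop_blk i v : AiT (Aop (adj := adj) (blk i v)) i = deg R adj i *: v.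
Proof.
have neq (e : edge adj) : (etail e == ehead e) = false.
  apply/negP => /eqP eq_ends; have /andP[] := valP e.
  by rewrite -/(etail e) -/(ehead e) eq_ends ltnn.
rewrite deg_edges /AiT scalerDl !scaler_suml -sumrN; congr (_ + _); apply: eq_bigr => e /eqP ei.
  by rewrite /Aop /blk /upd ei eqxx -ei eq_sym neq subr0 scale1r.
by rewrite /Aop /blk /upd ei eqxx -ei neq sub0r opprK scale1r.
Qed.

Lemma sum_nsq_Aop_blk i v : \sum_(e : edge adj) nsq (Aop (blk i v) e) = deg R adj i * nsq v.
Proof. by rewrite -[LHS]/(dotE _ _) dotE_Aop_blk AiT_Aop_blk dotvZl. Qed.

End Incidence.

(** * Convex functions with Lipschitz gradient *)

Section Calculus.
Variable R : realType.

(** Divide by [t] and let [t] tend to 0 from the right; the term in [c] disappears. It serves both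
    the gradient inequality and the stationarity conditions. *)
Lemma is_derive_le (phi : R -> R) (D K c : R) :
  is_derive (0 : R) 1 phi D ->
  (forall t, 0 < t <= 1 -> phi t - phi 0 <= t * K + t ^+ 2 * c) -> D <= K.
Proof.
move=> [dphi <-] phiK.
have slope : (fun t => t^-1 * (phi t - phi 0)) @ 0^'+ --> 'D_1 phi 0.
  apply: cvg_dnbhs_at_right; apply: cvg_trans dphi.
  by apply: near_eq_cvg; near=> t; rewrite /= addr0 [t *: 1]mulr1.
have bound : (fun t : R => K + t * c) @ 0^'+ --> K + 0 * c.
  by apply: cvgD; [exact: cvg_cst|apply: cvgMr_tmp; exact: cvg_within].
rewrite mul0r addr0 in bound.
apply: (ler_cvg_to slope bound); near=> t.
have t0 : 0 < t by near: t; exact: nbhs_right_gt.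
have t1 : t <= 1 by near: t; exact: nbhs_right_le.
rewrite -(ler_pM2l t0) mulVKf ?gt_eqF //.
by apply: le_trans (phiK t _) _; [rewrite t0|rewrite expr2; lra].
Unshelve. all: by end_near. Qed.

Section Gradient.
Variables (n : nat) (g : 'rV[R]_n * 'rV[R]_n -> R).
Variables gc gh : 'rV[R]_n * 'rV[R]_n -> 'rV[R]_n.
Hypothesis g_grad : has_gradient g gc gh.

Lemma is_derive_line (z h : 'rV[R]_n * 'rV[R]_n) (t : R) :
  is_derive t 1 (fun s : R => g (z + s *: h))
  (dotv (gc (z + t *: h)) h.1 + dotv (gh (z + t *: h)) h.2).
Proof.
have [dg Dg] := g_grad (z + t *: h).
have line : is_diff t (cst z + *:%R^~ h) (0 + *:%R^~ h) by exact: is_diffD.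
have dline := is_diff_comp line (differentiableP dg).
 apply: DeriveDef; first exact/derivable1_diffP.
rewrite -Dg -[RHS]/('d g (z + t *: h) h) deriveE //.
by rewrite -[X in 'd X _](_ : g \o (cst z + *:%R^~ h) = _) // diff_val /=
  -[(_ + _) 1]/(0 + 1 *: h) add0r scale1r.
Qed.

(** On the segment from [x] to [y], convexity bounds difference quotients at [x] by the chord slope
    [g y - g x]. *)
Lemma convex_grad_le (g_conv : jconvex g) x y :
  g x + dotv (gc x) (y.1 - x.1) + dotv (gh x) (y.2 - x.2) <= g y.
Proof.
have := is_derive_line x (y - x) 0; rewrite scale0r addr0 => /is_derive_le.
move=> /(_ (g y - g x) 0) ub.
suff : dotv (gc x) (y - x).1 + dotv (gh x) (y - x).2 <= g y - g x by move=> /=; lra.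
apply: ub => t /andP[t0 t1]; rewrite scale0r addr0 mulr0 addr0.
have := g_conv y x t; rewrite t1 ltW //= => /(_ isT).
suff -> : (t *: y.1 + (1 - t) *: x.1, t *: y.2 + (1 - t) *: x.2) = x + t *: (y - x) by lra.
by rewrite [RHS]surjective_pairing; congr pair => /=;
  rewrite scalerBl scale1r scalerBr addrCA addrA.
Qed.

Lemma lipschitz_nsq (C : R) (C0 : 0 <= C) (g_lip : lipschitz_grad gc gh C) z z' :
  nsq (gc z - gc z') + nsq (gh z - gh z') <=
  C ^+ 2 * (nsq (z.1 - z'.1) + nsq (z.2 - z'.2)).
Proof.
have ge0 (u v : 'rV[R]_n) : 0 <= nsq u + nsq v by rewrite addr_ge0 ?nsq_ge0.
have := g_lip z z'; rewrite -ler_sqr ?nnegrE ?mulr_ge0 ?sqrtr_ge0 //.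
by rewrite exprMn !sqr_sqrtr.
Qed.

(** The mean value theorem replaces integration: [phi] is [g] along the segment minus its quadratic
    upper model, and its derivative is nonpositive on []0, 1[], hence [phi 1 <= phi 0]. *)
Lemma descent_lemma (C : R) (C0 : 0 <= C) (g_lip : lipschitz_grad gc gh C) x y y' :
  g (x, y') <= g (x, y) + dotv (gh (x, y)) (y' - y) + C / 2 * nsq (y' - y).
Proof.
set v := y' - y.
pose phi t := g ((x, y) + t *: (0, v)) - t * dotv (gh (x, y)) v - t ^+ 2 * (C / 2 * nsq v).
have dphi (t : R) : is_derive t 1 phi
    (dotv (gh ((x, y) + t *: (0, v))) v - dotv (gh (x, y)) v - C * t * nsq v).
  have dg := is_derive_line (x, y) (0, v) t.
  apply: is_derive_eq.
  by rewrite /= dotv0 add0r /GRing.scale /= !mulr1; field.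
have [s] := @MVT R phi _ 0 1 ltr01 (fun t _ => dphi t)
  (derivable_within_continuous (fun t _ => ex_derive (is_derive := dphi t))).
rewrite in_itv /= => /andP[s0 _]; rewrite subr0 mulr1 => phi01.
(* At parameter [s] the gradient has moved by at most [C s |v|], so [dotv_le_nsq] applies with
   constant [C * s]. *)
have dphi_le0 : dotv (gh ((x, y) + s *: (0, v))) v - dotv (gh (x, y)) v <= C * s * nsq v.
  rewrite -dotvBl; apply: dotv_le_nsq; first by rewrite mulr_ge0 // ltW.
  have := lipschitz_nsq C0 g_lip ((x, y) + s *: (0, v)) (x, y).
  have -> : ((x, y) + s *: (0, v)).1 - x = 0 by rewrite /= scaler0 addr0 subrr.
  have -> : ((x, y) + s *: (0, v)).2 - y = s *: v by rewrite /= addrC addKr.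
  rewrite nsqZ {3}/nsq dot0v add0r exprMn mulrA => lip.
  by apply: le_trans lip; rewrite lerDr nsq_ge0.
have end1 : (x, y) + 1 *: (0, v) = (x, y').
  by rewrite scale1r; congr pair => /=; rewrite ?addr0 // addrC subrK.
have end0 : (x, y) + 0 *: (0, v) = (x, y) by rewrite scale0r addr0.
move: phi01; rewrite /phi end1 end0; lra.
Qed.

End Gradient.
End Calculus.

(** * Limits of vectors *)

Section Convergence.
Variables (R : realType) (n : nat).
Implicit Types (v l : 'rV[R]_n).

Lemma sqr_coord_le_nsq v j : v ord0 j ^+ 2 <= nsq v.
Proof.
rewrite /nsq /dotv (bigD1 j) //= -expr2 lerDl.
by apply: sumr_ge0 => i _; rewrite -expr2 sqr_ge0.
Qed.

(** [|v|] is the maximum norm; with [nsq_le_sqr_norm] this is the equivalence of norms behind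
    [cvg_nsqP]. *)
Lemma sqr_norm_le_nsq v : `|v| ^+ 2 <= nsq v.
Proof.
have [->|/mx_norm_neq0 [[i j] /= vij]] := eqVneq `|v| 0; first by rewrite expr0n nsq_ge0.
by rewrite (vij : `|v| = `|v i j|) (ord1 i) -normrX ger0_norm ?sqr_ge0 ?sqr_coord_le_nsq.
Qed.

Lemma nsq_le_sqr_norm v : nsq v <= n%:R * `|v| ^+ 2.
Proof.
rewrite -[X in X%:R](card_ord n) mulr_natl -sumr_const; apply: ler_sum => j _.
rewrite -expr2 -[X in X <= _]ger0_norm ?sqr_ge0 // normrX ler_sqr ?nnegrE //.
rewrite [leRHS]/Num.norm /= mx_normrE.
exact: (le_bigmax _ (fun ij : 'I_1 * 'I_n => `|v ij.1 ij.2|) (ord0, j)).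
Qed.

Lemma cvg_nsqP (T : Type) (F : set_system T) {FF : Filter F} (w : T -> 'rV[R]_n) l :
  w @ F --> l <-> nsq (w t - l) @[t --> F] --> (0 : R).
Proof.
split=> [wl|/cvgr0Pnorm_le wl]; last first.
  apply/cvgrPdist_le => e e0; have := wl (e ^+ 2) (exprn_gt0 _ e0).
  apply: filterS => t; rewrite ger0_norm ?nsq_ge0 // nsqB.
  by move=> /(le_trans (sqr_norm_le_nsq _)); rewrite ler_sqr ?nnegrE ?(ltW e0).
have norm0 : `|w t - l| @[t --> F] --> (0 : R).
  rewrite -(normr0 'rV[R]_n) -(subrr l).
  by apply: cvg_norm; apply: cvgB wl (cvg_cst _).
have up : n%:R * `|w t - l| ^+ 2 @[t --> F] --> (0 : R).
  rewrite -(mulr0 n%:R) -(mulr0 0); apply: cvgMl_tmp.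
  by under eq_fun do rewrite expr2; apply: cvgM.
apply: squeeze_cvgr (cvg_cst _) up.
by apply: nearW => t; rewrite nsq_ge0 nsq_le_sqr_norm.
Qed.

Lemma ultra_fmap (T T' : Type) (f : T -> T') (F : set_system T) :
  UltraFilter F -> UltraFilter (f @ F).
Proof.
move=> FU; split=> [|G GF FG]; first exact: fmap_proper_filter.
rewrite eqEsubset; split=> // A GA.
have [//|FnA] := in_ultra_setVsetC (f @^-1` A) FU.
have : G (A `&` ~` A) by apply: filterI => //; exact: FG.
by rewrite setICr => /filter_not_empty.
Qed.

(** The image ultrafilter contains a compact box, hence converges. *)
Lemma ultra_bounded_cvg (T : Type) (F : set_system T) (w : T -> 'rV[R]_n) l B :
  UltraFilter F -> (forall t, nsq (w t - l) <= B) -> exists l' : 'rV[R]_n, w @ F --> l'.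
Proof.
move=> FU wB.
(* The half-width [B + 1] suffices because [B <= (B + 1) ^+ 2] for [B >= 0]; this avoids a square
   root. *)
have box_compact : compact
    [set v : 'rV[R]_n | forall j, `[l ord0 j - (B + 1), l ord0 j + (B + 1)]%classic (v ord0 j)].
  apply: (@rV_compact _ _ (fun j => `[l ord0 j - (B + 1), l ord0 j + (B + 1)]%classic)).
  by move=> j; exact: segment_compact.
rewrite compact_ultra in box_compact.
have [|l' [_ wl']] := box_compact _ (ultra_fmap w FU); last by exists l'.
apply: (@filterE _ F) => t j /=; rewrite in_itv /=.
have := le_trans (sqr_coord_le_nsq _ j) (wB t); rewrite !mxE => wlB.
have B0 : 0 <= B by apply: le_trans wlB; exact: sqr_ge0.
set d := _ - _ in wlB; have -> : w t ord0 j = l ord0 j + d by rewrite /d addrC subrK.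
by rewrite !lerD2l -ler_norml -ler_sqr ?nnegrE ?addr_ge0 // real_normK ?num_real //; nra.
Qed.

Lemma dominated_cvg (T : Type) (F : set_system T) {FF : Filter F}
    (w : T -> 'rV[R]_n) l (c : R) (E : T -> R) :
  0 < c -> (forall t, c * nsq (w t - l) <= E t) -> E @ F --> (0 : R) -> w @ F --> l.
Proof.
move=> c0 wE E0; apply/cvg_nsqP.
have up : c^-1 * E t @[t --> F] --> (0 : R) by rewrite -(mulr0 c^-1); exact: cvgMl_tmp.
apply: squeeze_cvgr (cvg_cst _) up.
by apply: nearW => t; rewrite nsq_ge0 ler_pdivlMl ?wE.
Qed.

End Convergence.

Lemma cvg_sumr (R : numFieldType) (V : normedModType R) (T : Type) (F : set_system T)
    {FF : Filter F} (I : Type) (r : seq I) (P : pred I) (u : I -> T -> V) (l : I -> V) :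
  (forall i, P i -> u i @ F --> l i) ->
  \sum_(i <- r | P i) u i t @[t --> F] --> \sum_(i <- r | P i) l i.
Proof.
move=> ul; elim: r => [|i r ih].
  by rewrite big_nil; under eq_fun do rewrite big_nil; exact: cvg_cst.
rewrite big_cons; under eq_fun do rewrite big_cons.
by case: ifPn => // Pi; apply: cvgD => //; exact: ul.
Qed.

Lemma ler_term_sum (R : numDomainType) (I : finType) (F : I -> R) i :
  (forall j, 0 <= F j) -> F i <= \sum_j F j.
Proof. by move=> F0; rewrite (bigD1 i) //= lerDl sumr_ge0. Qed.

(** [V] is monotone and bounded below, hence convergent; [D k] lies between 0 and [V k - V k.+1],
    which vanishes. *)
Lemma summable_decrease (R : realType) (V D : nat -> R) :
  (forall k, 0 <= V k) -> (forall k, 0 <= D k) ->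
  (forall k, V k.+1 + D k <= V k) -> D @ \oo --> (0 : R).
Proof.
move=> V0 D0 dec.
have V_noninc : nonincreasing_seq V.
  by apply/nonincreasing_seqP => k; apply: le_trans (dec k); rewrite lerDl.
have V_cvg : cvgn V.
  by apply: nonincreasing_is_cvgn => //; exists 0 => _ [k _ <-].
have gap : V k - V k.+1 @[k --> \oo] --> (0 : R).
  rewrite -(subrr (limn V)); apply: cvgB => //.
  by rewrite -(cvg_shiftS V) in V_cvg *.
apply: squeeze_cvgr (cvg_cst _) gap.
by apply: nearW => k; rewrite D0 lerBrDl dec.
Qed.

(** * Optimality conditions of the subproblems *)

Section Stationarity.
Variables (R : realType) (n : nat).

(** The increment of the objective in direction [h] is split into that of [phi h], known only
    through its derivative at 0, and an explicit quadratic in [t]. Testing [h] and [- h] gives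
    equality. *)
Lemma stationary_min (phi : 'rV[R]_n -> R -> R) (c : 'rV[R]_n -> R) (G p : 'rV[R]_n) :
  (forall h, is_derive (0 : R) 1 (phi h) (dotv G h)) ->
  (forall h t, 0 <= phi h t - phi h 0 + t * dotv p h + t ^+ 2 * c h) ->
  G + p = 0.
Proof.
move=> dphi phi_min.
have ge0 h : 0 <= dotv (G + p) h.
  have dNphi : is_derive (0 : R) 1 (- phi h) (- dotv G h) by exact: is_deriveN.
  have : - dotv G h <= dotv p h.
    apply: (is_derive_le (c := c h) dNphi) => t _.
    by have := phi_min h t; rewrite -![(- phi h) _]/(- phi h _); lra.
  by rewrite dotvDl; lra.
apply: dotv_eq0 => v; apply/eqP; rewrite eq_le ge0 andbT.
by have := ge0 (- v); rewrite dotvNr oppr_ge0.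
Qed.

Variables (N : nat) (adj : rel 'I_N).
Hypotheses (adjC : symmetric adj) (adjI : irreflexive adj).
Implicit Types (w u : 'rV[R]_n) (W : 'I_N -> 'rV[R]_n) (lam : edge adj -> 'rV[R]_n).

Lemma Aop_upd_add W i w u (e : edge adj) :
  Aop (upd W i (w + u)) e = Aop (upd W i w) e + Aop (blk i u) e.
Proof.
have upd_add j : upd W i (w + u) j = upd W i w j + blk i u j.
  by rewrite /blk /upd; case: eqP; rewrite ?addr0.
by rewrite /Aop !upd_add opprD addrACA.
Qed.

Lemma Aop_upd W i w (e : edge adj) :
  Aop (upd W i w) e = Aop W e + Aop (blk i (w - W i)) e.
Proof.
rewrite -[in LHS](subrKC (W i) w) Aop_upd_add; congr (_ + _).
by rewrite /Aop /upd; do 2![case: eqP => [->|_]].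
Qed.

(** Exact expansion of the augmented Lagrangian in one block: the coupling terms are quadratic, and
    [A_i^T A_i = d_i I] gives the second-order coefficient. *)
Lemma Lrho_upd_add (f : 'I_N -> 'rV[R]_n * 'rV[R]_n -> R) mu1 mu2 rho W Wh lam i w u :
  Lrho f mu1 mu2 rho (upd W i (w + u)) Wh lam - Lrho f mu1 mu2 rho (upd W i w) Wh lam =
  Fi (f i) mu1 mu2 (w + u) (Wh i) - Fi (f i) mu1 mu2 w (Wh i)
  + dotv (rho *: AiT (Aop (adj := adj) (upd W i w)) i - AiT lam i) u
  + rho / 2 * deg R adj i * nsq u.
Proof.
have F_upd v : Ftot f mu1 mu2 (upd W i v) Wh = Fi (f i) mu1 mu2 v (Wh i)
    + \sum_(j | j != i) Fi (f j) mu1 mu2 (W j) (Wh j).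
  rewrite /Ftot (bigD1 i) //= /upd eqxx; congr (_ + _).
  by apply: eq_bigr => j /negPf ->.
have lin : \sum_(e : edge adj) dotv (lam e) (Aop (upd W i (w + u)) e) =
    \sum_(e : edge adj) dotv (lam e) (Aop (upd W i w) e) + dotv (AiT lam i) u.
  rewrite -dotE_Aop_blk -big_split; apply: eq_bigr => e _.
  by rewrite Aop_upd_add dotvDr.
have quad : \sum_(e : edge adj) nsq (Aop (upd W i (w + u)) e) =
    \sum_(e : edge adj) nsq (Aop (upd W i w) e)
    + 2 * dotv (AiT (Aop (adj := adj) (upd W i w)) i) u + deg R adj i * nsq u.
  rewrite -dotE_Aop_blk -sum_nsq_Aop_blk // mulr_sumr -!big_split.
  by apply: eq_bigr => e _; rewrite Aop_upd_add nsqD.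
by rewrite /Lrho !F_upd lin quad (dotvBl (rho *: _)) dotvZl; field.
Qed.

End Stationarity.

Section Iteration.
Variables (R : realType) (n N : nat) (adj : rel 'I_N).
Variables (f : 'I_N -> 'rV[R]_n * 'rV[R]_n -> R).
Variables (gc gh : 'I_N -> 'rV[R]_n * 'rV[R]_n -> 'rV[R]_n).
Variables (mu1 mu2 rho gamma : R) (tau zeta : 'I_N -> R).
Variables (Wc Wh : nat -> 'I_N -> 'rV[R]_n) (lam : nat -> edge adj -> 'rV[R]_n).
Hypotheses (adjC : symmetric adj) (adjI : irreflexive adj).
Hypothesis f_grad : forall i, has_gradient (f i) (gc i) (gh i).

Lemma Wc_stationary k i : alg_step f mu1 mu2 rho gamma tau zeta Wc Wh lam k ->
  gc i (Wc k.+1 i, Wh k i)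
  + (mu1 *: Wc k.+1 i + rho *: AiT (Aop (adj := adj) (Wc k)) i - AiT (lam k) i
     + (tau i + rho * deg R adj i) *: (Wc k.+1 i - Wc k i)) = 0.
Proof.
move=> [Wc_min _]; set x' := Wc k.+1 i; set x := Wc k i; set y := Wh k i.
(* [phi] keeps only [f i]; the regularizer, the penalty and the proximal term are quadratic and
   supply [p] and [c]. *)
apply: (stationary_min (phi := fun h t => f i ((x', y) + t *: (h, 0)))
  (c := fun h => (mu1 + rho * deg R adj i + tau i) / 2 * nsq h)) => [h|h t].
  have := is_derive_line (f_grad i) (x', y) (h, 0) 0.
  by rewrite scale0r addr0 /= dotv0 addr0.
have := Wc_min i (x' + t *: h); rewrite -/x' -/x.
have := Lrho_upd_add adjC adjI f mu1 mu2 rho (Wc k) (Wh k) (lam k) i x' (t *: h).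
(* Only block [i] has moved from iterate [k]; the resulting [d_i (x' - x)] raises the proximal
   weight from [tau i] to [tau i + rho d_i]. *)
have -> : AiT (Aop (adj := adj) (upd (Wc k) i x')) i =
    AiT (Aop (adj := adj) (Wc k)) i + deg R adj i *: (x' - x).
  by rewrite -AiT_Aop_blk // -AiTD; congr AiT; apply/funext => e; rewrite Aop_upd.
have -> : (x', y) + t *: (h, 0) = (x' + t *: h, y).
  by congr pair; rewrite /= scaler0 addr0.
have -> : (x', y) + 0 *: (h, 0) = (x', y) by rewrite scale0r addr0.
have -> : x' + t *: h - x = (x' - x) + t *: h by rewrite addrAC.
move: (AiT (Aop _) i) (AiT (lam k) i) => a b.
rewrite /Fi -/y !nsqD nsqZ !dotvE.
lra.
Qed.

Lemma Wh_stationary k i : alg_step f mu1 mu2 rho gamma tau zeta Wc Wh lam k ->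
  gh i (Wc k.+1 i, Wh k.+1 i)
  + (mu2 *: Wh k.+1 i + zeta i *: (Wh k.+1 i - Wh k i)) = 0.
Proof.
move=> [_ [_ Wh_min]]; set x := Wc k.+1 i; set y' := Wh k.+1 i; set y := Wh k i.
apply: (stationary_min (phi := fun h t => f i ((x, y') + t *: (0, h)))
  (c := fun h => (mu2 + zeta i) / 2 * nsq h)) => [h|h t].
  have := is_derive_line (f_grad i) (x, y') (0, h) 0.
  by rewrite scale0r addr0 /= dotv0 add0r.
have := Wh_min i (y' + t *: h); rewrite -/x -/y' -/y.
have -> : (x, y') + t *: (0, h) = (x, y' + t *: h).
  by congr pair; rewrite /= scaler0 addr0.
have -> : (x, y') + 0 *: (0, h) = (x, y') by rewrite scale0r addr0.
have -> : y' + t *: h - y = (y' - y) + t *: h by rewrite addrAC.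
rewrite /Fi !nsqD nsqZ !dotvE; lra.
Qed.

End Iteration.

(** * Energy estimate for the second block of one node *)

Section NodeInequality.
Variables (R : realType) (n : nat) (g : 'rV[R]_n * 'rV[R]_n -> R).
Variables (gc gh : 'rV[R]_n * 'rV[R]_n -> 'rV[R]_n) (C m mu2 zeta : R).
Hypotheses (g_conv : jconvex g) (g_grad : has_gradient g gc gh).
Hypotheses (C0 : 0 <= C) (g_lip : lipschitz_grad gc gh C).
Hypotheses (m0 : 0 < m) (m_mu2 : m <= mu2).

(* Convexity is used at the mixed point (x', y) at which the gradient step in
   [x] is taken; the descent lemma then moves from [y] to [y'], so that the
   linear term in [x] needs no strong convexity. *)
Lemma node_decrease (xs ys x' y y' : 'rV[R]_n) :
  gh (xs, ys) + mu2 *: ys = 0 ->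
  gh (x', y') + (mu2 *: y' + zeta *: (y' - y)) = 0 ->
  zeta / 2 * nsq (y' - ys) + (zeta - C / m * (C + m)) / 2 * nsq (y' - y) <=
  zeta / 2 * nsq (y - ys) + dotv (gc (x', y) - gc (xs, ys)) (x' - xs).
Proof.
move=> KKTs opt.
have := convex_grad_le g_grad g_conv (x', y) (xs, ys).
have := convex_grad_le g_grad g_conv (xs, ys) (x', y').
have := descent_lemma g_grad C0 g_lip x' y y'.
rewrite /=.
have -> : xs - x' = - (x' - xs) by rewrite opprB.
have -> : ys - y = (y' - y) - (y' - ys) by rewrite opprB [RHS]addrC addrA subrK.
have -> : y - ys = (y' - ys) - (y' - y) by rewrite opprB [RHS]addrC addrA subrK.
have {KKTs} -> : gh (xs, ys) = - (mu2 *: ys) by apply/eqP; rewrite -addr_eq0 KKTs.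
(* Convexity involves the gradient at the old [y], the optimality condition the one at [y']; [dlt]
   is the discrepancy. *)
pose dlt := gh (x', y) - gh (x', y').
have dlt_lip : nsq dlt <= C ^+ 2 * nsq (y' - y).
  have := lipschitz_nsq C0 g_lip (x', y) (x', y').
  rewrite /= subrr {3}/nsq dot0v add0r (nsqB y) => lip.
  by apply: le_trans lip; rewrite lerDr nsq_ge0.
have -> : gh (x', y) = dlt - (mu2 *: y' + zeta *: (y' - y)).
  rewrite /dlt; have -> : gh (x', y') = - (mu2 *: y' + zeta *: (y' - y)).
    by apply/eqP; rewrite -addr_eq0 opt.
  by rewrite opprK addrK.
have -> : mu2 *: y' = mu2 *: ys + mu2 *: (y' - ys) by rewrite scalerBr addrCA subrr addr0.
clearbody dlt; move: dlt_lip; move: (gc _) (gc _) (y' - y) (y' - ys) (x' - xs) => p q d e h.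
rewrite -(ler_pM2l (_ : 0 < m^-1 / 2)) ?divr_gt0 ?invr_gt0 // => dlt_lip.
have e_mu2 : m * nsq e <= mu2 * nsq e by rewrite ler_wpM2r ?nsq_ge0.
(* Young with weight [1 / m] costs [C^2 / (2 m) |y' - y|^2], and the descent lemma
   [C / 2 |y' - y|^2]. The other half of Young, [m / 2 |y' - ys|^2], is absorbed by the strongly
   convex term since [m <= mu2]. *)
have := @young _ _ m^-1 dlt e; rewrite invr_gt0 => /(_ m0).
have -> : (2 / m)^-1 = m / 2 by rewrite invf_div.
have -> : C / m * (C + m) = m^-1 * C ^+ 2 + C by field; rewrite gt_eqF.
rewrite nsqD nsqN !dotvE -/(nsq d) (dotvC e d) -!/(nsq _).
have : 0 <= m * nsq e by rewrite mulr_ge0 ?nsq_ge0 ?ltW.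
by move: m^-1 dlt_lip => mV; lra.
Qed.

End NodeInequality.

(** * Lyapunov function *)

Section Lyapunov.
Variables (R : realType) (n N : nat) (adj : rel 'I_N).
Variables (f : 'I_N -> 'rV[R]_n * 'rV[R]_n -> R).
Variables (gc gh : 'I_N -> 'rV[R]_n * 'rV[R]_n -> 'rV[R]_n) (C : 'I_N -> R).
Variables (mu1 mu2 m rho gamma : R) (tau zeta eps : 'I_N -> R).
Variables (Wc Wh : nat -> 'I_N -> 'rV[R]_n) (lam : nat -> edge adj -> 'rV[R]_n).
Hypotheses (adjC : symmetric adj) (adjI : irreflexive adj).
Hypothesis f_conv : forall i, jconvex (f i).
Hypothesis f_grad : forall i, has_gradient (f i) (gc i) (gh i).
Hypothesis C0 : forall i, 0 <= C i.
Hypothesis f_lip : forall i, lipschitz_grad (gc i) (gh i) (C i).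
Hypotheses (mu1_ge0 : 0 <= mu1) (m0 : 0 < m) (m_mu2 : m <= mu2).
Hypotheses (rho0 : 0 < rho) (gamma0 : 0 < gamma) (eps0 : forall i, 0 < eps i).
Hypothesis step : forall k, alg_step f mu1 mu2 rho gamma tau zeta Wc Wh lam k.

Local Notation d := (deg R adj).
Local Notation A W := (Aop (adj := adj) W).

Definition lyap Xs Ys (Ls : edge adj -> 'rV[R]_n) k : R :=
  (2 * gamma * rho)^-1 * \sum_e nsq (lam k e - Ls e)
  + \sum_i ((tau i + rho * d i) / 2 * nsq (Wc k i - Xs i)
            + zeta i / 2 * nsq (Wh k i - Ys i)).

(** The guaranteed decrease of [lyap]. The subtracted [\sum_i eps i] and [rho * d i / eps i] are the
    two sides of Young's inequality in [cross_le]. *)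
Definition lyap_gap k : R :=
  (2 - gamma - \sum_i eps i) * rho / 2 * \sum_e nsq (A (Wc k.+1) e)
  + \sum_i ((tau i + rho * d i - rho * d i / eps i) / 2 * nsq (Wc k.+1 i - Wc k i)
            + (zeta i - C i / m * (C i + m)) / 2 * nsq (Wh k.+1 i - Wh k i)).

(** Insert both stationarity conditions into [node_decrease]; expanding squares turns the proximal
    product into a difference of energies. The nonnegative [mu1 |x+ - xs|^2] is dropped, and the
    multiplier term is left for the edges. *)
Lemma node_lyap Xs Ys (Ls : edge adj -> 'rV[R]_n) k i :
  KKT gc gh mu1 mu2 Xs Ys Ls ->
  (tau i + rho * d i) / 2 * nsq (Wc k.+1 i - Xs i) + zeta i / 2 * nsq (Wh k.+1 i - Ys i)
  + ((tau i + rho * d i) / 2 * nsq (Wc k.+1 i - Wc k i)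
     + (zeta i - C i / m * (C i + m)) / 2 * nsq (Wh k.+1 i - Wh k i)) <=
  (tau i + rho * d i) / 2 * nsq (Wc k i - Xs i) + zeta i / 2 * nsq (Wh k i - Ys i)
  + dotv (AiT (fun e => lam k e - Ls e - rho *: A (Wc k) e) i) (Wc k.+1 i - Xs i).
Proof.
move=> [_ [KKTc KKTh]].
have := node_decrease (f_conv i) (f_grad i) (C0 i) (f_lip i) m0 m_mu2
  (KKTh i) (Wh_stationary f_grad i (step k)).
have := Wc_stationary adjC adjI f_grad i (step k).
move: (gc i _) => p /eqP; rewrite addr_eq0 => /eqP ->.
have -> : gc i (Xs i, Ys i) = AiT Ls i - mu1 *: Xs i by rewrite KKTc addrK.
have -> : AiT (fun e => lam k e - Ls e - rho *: A (Wc k) e) i =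
    AiT (lam k) i - AiT Ls i - rho *: AiT (A (Wc k)) i.
  have AiTN (mu : edge adj -> 'rV[R]_n) : AiT (fun e => - mu e) i = - AiT mu i.
    by rewrite -scaleN1r -AiTZ; congr AiT; apply/funext => e; rewrite scaleN1r.
  by rewrite AiTD AiTN AiTZ AiTD AiTN.
have -> : Wc k i - Xs i = (Wc k.+1 i - Xs i) - (Wc k.+1 i - Wc k i).
  by rewrite opprB [RHS]addrC addrA subrK.
have -> : mu1 *: Wc k.+1 i = mu1 *: (Wc k.+1 i - Xs i) + mu1 *: Xs i.
  by rewrite -scalerDr subrK.
move: (AiT _ i) (AiT _ i) (AiT _ i) => a b c.
move: (Wc k.+1 i - Xs i) (Wc k.+1 i - Wc k i) => e u.
have := mulr_ge0 mu1_ge0 (nsq_ge0 e).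
rewrite (nsqD e) nsqN !dotvE -!/(nsq _) (dotvC e u); lra.
Qed.

Lemma dotE_Aop_sub Xs Ys (Ls mu : edge adj -> 'rV[R]_n) k :
  KKT gc gh mu1 mu2 Xs Ys Ls ->
  \sum_i dotv (AiT mu i) (Wc k i - Xs i) = dotE mu (A (Wc k)).
Proof.
move=> [feas _]; rewrite -(dotE_Aop mu (fun i => Wc k i - Xs i)).
by apply: eq_bigr => e _; rewrite AopB feas subr0.
Qed.

(** The weight [1 / (2 gamma rho)] makes the product of [lam k - Ls] with [A x+] cancel after the
    dual update. Writing [A x = A x+ - A (x+ - x)] in the rest leaves the residual square and the
    cross term. *)
Lemma edge_lyap (Ls : edge adj -> 'rV[R]_n) k e :
  (2 * gamma * rho)^-1 * nsq (lam k.+1 e - Ls e)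
  + dotv (lam k e - Ls e - rho *: A (Wc k) e) (A (Wc k.+1) e) =
  (2 * gamma * rho)^-1 * nsq (lam k e - Ls e)
  - (1 - gamma / 2) * rho * nsq (A (Wc k.+1) e)
  + rho * dotv (A (Wc k.+1) e) (A (fun i => Wc k.+1 i - Wc k i) e).
Proof.
have [_ [-> _]] := step k.
rewrite AopB; move: (A _ e) (A _ e) => r s.
rewrite addrAC; move: (lam k e - Ls e) => a.
rewrite nsqD nsqN nsqZ !dotvE -!/(nsq _) (dotvC s r).
by field; rewrite !gt_eqF.
Qed.

(** Young is applied node by node with weight [eps i] to the whole residual, so the weights add up
    to [\sum_i eps i]; the other factor is [|A_i u|^2 = d_i |u|^2]. *)
Lemma cross_le k :
  dotE (A (Wc k.+1)) (A (fun i => Wc k.+1 i - Wc k i)) <=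
  \sum_i (eps i / 2 * \sum_e nsq (A (Wc k.+1) e)
          + d i / (2 * eps i) * nsq (Wc k.+1 i - Wc k i)).
Proof.
rewrite dotE_Aop; apply: ler_sum => i _.
rewrite -dotE_Aop_blk [X in _ <= _ + X]mulrAC -sum_nsq_Aop_blk // mulr_sumr mulr_suml -big_split.
by apply: ler_sum => e _; rewrite (mulrC _ (2 * eps i)^-1) young.
Qed.

(** Adding the node and edge estimates cancels [dotE mu (A x+)]; [cross_le] bounds the one term
    without a sign. *)
Lemma lyap_decrease Xs Ys (Ls : edge adj -> 'rV[R]_n) k :
  KKT gc gh mu1 mu2 Xs Ys Ls ->
  lyap Xs Ys Ls k.+1 + lyap_gap k <= lyap Xs Ys Ls k.
Proof.
move=> kkt; pose S := \sum_e nsq (A (Wc k.+1) e).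
pose X j i := (tau i + rho * d i) / 2 * nsq (Wc j i - Xs i) + zeta i / 2 * nsq (Wh j i - Ys i).
pose G i := (tau i + rho * d i) / 2 * nsq (Wc k.+1 i - Wc k i)
  + (zeta i - C i / m * (C i + m)) / 2 * nsq (Wh k.+1 i - Wh k i).
pose mu e := lam k e - Ls e - rho *: A (Wc k) e.
pose T := \sum_i d i / (2 * eps i) * nsq (Wc k.+1 i - Wc k i).
have nodes : \sum_i X k.+1 i + \sum_i G i <= \sum_i X k i + dotE mu (A (Wc k.+1)).
  rewrite -(dotE_Aop_sub _ _ kkt) -!big_split; apply: ler_sum => i _.
  exact: node_lyap.
pose c : R := (2 * gamma * rho)^-1.
have edges : c * \sum_e nsq (lam k.+1 e - Ls e) + dotE mu (A (Wc k.+1)) =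
    c * \sum_e nsq (lam k e - Ls e) - (1 - gamma / 2) * rho * S
    + rho * dotE (A (Wc k.+1)) (A (fun i => Wc k.+1 i - Wc k i)).
  have := eq_bigr (op := +%R) (idx := 0 : R) (r := index_enum _) (P := xpredT) _
    (fun e _ => edge_lyap Ls k e).
  by rewrite !big_split /= sumrN -!mulr_sumr.
have cross := cross_le k; rewrite -/S big_split -/T -mulr_suml -mulr_suml /= in cross.
rewrite -(ler_pM2l rho0) in cross.
have gapE : lyap_gap k =
    (2 - gamma - \sum_i eps i) * rho / 2 * S + (\sum_i G i - rho * T).
  rewrite /lyap_gap /T [rho * \sum_i _]mulr_sumr -sumrB; congr (_ + _).
  by apply: eq_bigr => i _; rewrite /G; field; rewrite !gt_eqF.
rewrite /lyap gapE -/c; lra.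
Qed.

(** * Convergence under the parameter conditions *)

Hypotheses (tau0 : forall i, 0 < tau i) (zeta0 : forall i, 0 < zeta i).
Hypothesis tau_gap : forall i, rho * (1 / eps i - 1) * d i < tau i.
Hypothesis zeta_gap : forall i, C i / m * (C i + m) < zeta i.
Hypothesis eps_gap : \sum_i eps i < 2 - gamma.

Let tau_rho_gt0 i : 0 < (tau i + rho * d i) / 2.
Proof. by rewrite divr_gt0 // ltr_wpDr // mulr_ge0 // ltW. Qed.

Let tau_gap_gt0 i : 0 < (tau i + rho * d i - rho * d i / eps i) / 2.
Proof.
rewrite divr_gt0 // subr_gt0 -ltrBlDr; apply: le_lt_trans (tau_gap i).
by rewrite mulrBr mulrBl mulr1 mulrA mulr1 mulrAC.
Qed.

Let zeta_gap_gt0 i : 0 < (zeta i - C i / m * (C i + m)) / 2.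
Proof. by rewrite divr_gt0 // subr_gt0. Qed.

Let zeta_gt0 i : 0 < zeta i / 2.
Proof. by rewrite divr_gt0. Qed.

Let dual_gt0 : 0 < (2 * gamma * rho)^-1.
Proof. by rewrite invr_gt0 !mulr_gt0. Qed.

Let eps_gap_gt0 : 0 < (2 - gamma - \sum_i eps i) * rho / 2.
Proof. by rewrite divr_gt0 // mulr_gt0 // subr_gt0. Qed.

(* [lyap] and [lyap_gap] are both of this form. *)
Lemma block_energy_ge (b : R) (p q : 'I_N -> R) (mu : edge adj -> 'rV[R]_n)
    (x y : 'I_N -> 'rV[R]_n) (E := b * \sum_e nsq (mu e)
      + \sum_i (p i * nsq (x i) + q i * nsq (y i))) :
  0 < b -> (forall i, 0 < p i) -> (forall i, 0 < q i) ->
  [/\ 0 <= E, forall e, b * nsq (mu e) <= E, forall i, p i * nsq (x i) <= E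
    & forall i, q i * nsq (y i) <= E].
Proof.
move=> b0 p0 q0.
have nn c (v : 'rV[R]_n) : 0 < c -> 0 <= c * nsq v.
  by move=> c0; rewrite mulr_ge0 ?nsq_ge0 ?ltW.
have sum_ge0 : 0 <= \sum_i (p i * nsq (x i) + q i * nsq (y i)).
  by apply: sumr_ge0 => i _; rewrite addr_ge0 ?nn.
have dual_ge0 : 0 <= b * \sum_e nsq (mu e).
  by apply: mulr_ge0; [exact: ltW|apply: sumr_ge0 => e _; exact: nsq_ge0].
have node i : p i * nsq (x i) + q i * nsq (y i) <= E.
  apply: le_trans (_ : _ <= \sum_i (p i * nsq (x i) + q i * nsq (y i))) _.
    by apply: (ler_term_sum (F := fun j => p j * nsq (x j) + q j * nsq (y j))) => j;
      rewrite addr_ge0 ?nn.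
  by rewrite /E lerDr.
split=> [|e|i|i].
- by rewrite addr_ge0.
- apply: le_trans (_ : _ <= b * \sum_e nsq (mu e)) _; last by rewrite /E lerDl.
  rewrite ler_pM2l //.
  by apply: (ler_term_sum (F := fun e => nsq (mu e))) => ?; rewrite nsq_ge0.
- by apply: le_trans (node i); rewrite lerDl nn.
- by apply: le_trans (node i); rewrite lerDr nn.
Qed.

Let lyap_bounds (Xs Ys : 'I_N -> 'rV[R]_n) (Ls : edge adj -> 'rV[R]_n) k :=
  block_energy_ge (fun e => lam k e - Ls e)
  (fun i => Wc k i - Xs i) (fun i => Wh k i - Ys i) dual_gt0 tau_rho_gt0 zeta_gt0.

Let gap_bounds k := block_energy_ge (A (Wc k.+1)) (fun i => Wc k.+1 i - Wc k i)
  (fun i => Wh k.+1 i - Wh k i) eps_gap_gt0 tau_gap_gt0 zeta_gap_gt0.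

Lemma cvg_AiT (T : Type) (F : set_system T) {FF : Filter F}
    (mu : T -> edge adj -> 'rV[R]_n) (l : edge adj -> 'rV[R]_n) i :
  (forall e, mu t e @[t --> F] --> l e) -> AiT (mu t) i @[t --> F] --> AiT l i.
Proof. by move=> mul; apply: cvgB; apply: cvg_sumr => e _; exact: mul. Qed.

Lemma cvg_gc (T : Type) (F : set_system T) {FF : Filter F}
    (x y : T -> 'rV[R]_n) xs ys i :
  x @ F --> xs -> y @ F --> ys ->
  gc i (x t, y t) @[t --> F] --> gc i (xs, ys) /\
  gh i (x t, y t) @[t --> F] --> gh i (xs, ys).
Proof.
move=> /cvg_nsqP xl /cvg_nsqP yl.
have up : C i ^+ 2 * (nsq (x t - xs) + nsq (y t - ys)) @[t --> F] --> (0 : R).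
  by rewrite -(mulr0 (C i ^+ 2)) -[X in _ * X]addr0; apply: cvgMl_tmp; exact: cvgD.
have bound t := lipschitz_nsq (C0 i) (f_lip i) (x t, y t) (xs, ys).
split; apply/cvg_nsqP; apply: squeeze_cvgr (cvg_cst _) up; apply: nearW => t.
- rewrite nsq_ge0; apply: le_trans (bound t); by rewrite lerDl nsq_ge0.
- rewrite nsq_ge0; apply: le_trans (bound t); by rewrite lerDr nsq_ge0.
Qed.

Lemma lyap_noninc Xs Ys (Ls : edge adj -> 'rV[R]_n) :
  KKT gc gh mu1 mu2 Xs Ys Ls -> nonincreasing_seq (lyap Xs Ys Ls).
Proof.
move=> kkt; apply/nonincreasing_seqP => k; apply: le_trans (lyap_decrease k kkt).
by rewrite lerDl; have [] := gap_bounds k.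
Qed.

Lemma gap_cvg0 Xs Ys (Ls : edge adj -> 'rV[R]_n) :
  KKT gc gh mu1 mu2 Xs Ys Ls ->
  [/\ forall e, A (Wc k.+1) e @[k --> \oo] --> (0 : 'rV[R]_n),
      forall i, Wc k.+1 i - Wc k i @[k --> \oo] --> (0 : 'rV[R]_n)
    & forall i, Wh k.+1 i - Wh k i @[k --> \oo] --> (0 : 'rV[R]_n)].
Proof.
move=> kkt.
have gap0 : lyap_gap @ \oo --> (0 : R).
  apply: (summable_decrease (V := lyap Xs Ys Ls)) => k; last exact: lyap_decrease.
    by have [] := lyap_bounds Xs Ys Ls k.
  by have [] := gap_bounds k.
split=> [e|i|i].
- by apply: (dominated_cvg eps_gap_gt0 _ gap0) => k; rewrite subr0; have [] := gap_bounds k.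
- by apply: (dominated_cvg (tau_gap_gt0 i) _ gap0) => k; rewrite subr0; have [] := gap_bounds k.
- by apply: (dominated_cvg (zeta_gap_gt0 i) _ gap0) => k; rewrite subr0; have [] := gap_bounds k.
Qed.

Lemma iterates_cvg Xs0 Ys0 (Ls0 : edge adj -> 'rV[R]_n) :
  KKT gc gh mu1 mu2 Xs0 Ys0 Ls0 ->
  exists Xs Ys (Ls : edge adj -> 'rV[R]_n),
    [/\ KKT gc gh mu1 mu2 Xs Ys Ls,
        forall i, Wc k i @[k --> \oo] --> Xs i,
        forall i, Wh k i @[k --> \oo] --> Ys i
      & forall e, lam k e @[k --> \oo] --> Ls e].
Proof.
move=> kkt0.
(* A single ultrafilter serves all nodes and edges at once, in place of nested subsequences. *)
have [U [UU ooU]] := ultraFilterLemma (eventually_filter : ProperFilter \oo).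
have UP : ProperFilter U by exact: ultra_proper.
have toU (T : Type) (u : nat -> T) (G : set_system T) : u @ \oo `=>` G -> u @ U `=>` G.
  by move=> uG B /uG; exact: ooU.
have le0 k : lyap Xs0 Ys0 Ls0 k <= lyap Xs0 Ys0 Ls0 0 by exact: lyap_noninc kkt0 _ _ _.
have ultra_lim (w : nat -> 'rV[R]_n) l (c : R) : 0 < c ->
    (forall k, c * nsq (w k - l) <= lyap Xs0 Ys0 Ls0 k) -> exists l' : 'rV[R]_n, w @ U --> l'.
  move=> c0 wB; apply: (ultra_bounded_cvg (l := l) (B := c^-1 * lyap Xs0 Ys0 Ls0 0) UU) => k.
  by rewrite ler_pdivlMl //; apply: le_trans (wB k) (le0 k).
have /choice[Xs Xlim] : forall i, exists l : 'rV[R]_n, Wc k i @[k --> U] --> l.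
  move=> i; apply: (ultra_lim _ (Xs0 i) _ (tau_rho_gt0 i)) => k.
  by have [] := lyap_bounds Xs0 Ys0 Ls0 k.
have /choice[Ys Ylim] : forall i, exists l : 'rV[R]_n, Wh k i @[k --> U] --> l.
  move=> i; apply: (ultra_lim _ (Ys0 i) _ (zeta_gt0 i)) => k.
  by have [] := lyap_bounds Xs0 Ys0 Ls0 k.
have /choice[Ls Llim] : forall e, exists l : 'rV[R]_n, lam k e @[k --> U] --> l.
  move=> e; apply: (ultra_lim _ (Ls0 e) _ dual_gt0) => k.
  by have [] := lyap_bounds Xs0 Ys0 Ls0 k.
have [r0 dx0 dy0] := gap_cvg0 kkt0.
(* [U] need not be invariant under the shift of indices; the limit of [w k.+1] comes from the
   vanishing differences. *)
have next (w : nat -> 'rV[R]_n) (l : 'rV[R]_n) : w @ U --> l ->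
    w k.+1 - w k @[k --> \oo] --> (0 : 'rV[R]_n) -> w k.+1 @[k --> U] --> l.
  move=> wl /toU dw; rewrite -(addr0 l).
  rewrite (_ : (fun k => w k.+1) = (fun k => w k + (w k.+1 - w k))); first exact: cvgD.
  by apply/funext => k; rewrite addrC subrK.
have lim0 (u : nat -> 'rV[R]_n) (l : 'rV[R]_n) :
    u @ U --> l -> (forall k, u k = 0) -> l = 0.
  move=> ul u0; apply: (norm_cvg_unique ul).
  by apply: cvg_near_cst; apply: nearW.
have Xlim' i := next _ _ (Xlim i) (dx0 i).
have Ylim' i := next _ _ (Ylim i) (dy0 i).
have feas (e : edge adj) : Aop Xs e = 0.
  have lim_A : A (Wc k.+1) e @[k --> U] --> Aop Xs e by exact: cvgB.
  exact: norm_cvg_unique lim_A (toU _ _ _ (r0 e)).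
have AiT_feas i : AiT (A Xs) i = 0.
  by rewrite /AiT !big1 ?subrr // => e _; rewrite feas.
have kkt : KKT gc gh mu1 mu2 Xs Ys Ls.
  split=> //; split=> i.
    (* The gradient is taken at [(x+, y)], hence the shifted limit for [x] only. *)
    have [gc_lim _] := cvg_gc i (Xlim' i) (Ylim i).
    have A_lim (e : edge adj) : A (Wc k) e @[k --> U] --> Aop Xs e by exact: cvgB.
    have stat : gc i (Xs i, Ys i) + (mu1 *: Xs i + rho *: AiT (A Xs) i - AiT Ls i
        + (tau i + rho * d i) *: 0) = 0.
      apply: (lim0 _ _ _ (fun k => Wc_stationary adjC adjI f_grad i (step k))).
      apply: cvgD => //; apply: cvgD; last exact: (cvgZl_tmp (toU _ _ _ (dx0 i))).
      apply: cvgB; last exact: cvg_AiT.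
      by apply: cvgD; apply: cvgZl_tmp => //; exact: cvg_AiT.
    apply/esym/eqP; rewrite -subr_eq0 -stat AiT_feas !scaler0 !addr0.
    by rewrite -!addrA.
  have [_ gh_lim] := cvg_gc i (Xlim' i) (Ylim' i).
  have stat : gh i (Xs i, Ys i) + (mu2 *: Ys i + zeta i *: 0) = 0.
    apply: (lim0 _ _ _ (fun k => Wh_stationary f_grad i (step k))).
    apply: cvgD => //; apply: cvgD; apply: cvgZl_tmp => //; exact: (toU _ _ _ (dy0 i)).
  by rewrite scaler0 addr0 in stat.
exists Xs, Ys, Ls.
have lyap_U : lyap Xs Ys Ls @ U --> (0 : R).
  have nsq_lim (c : R) (w : nat -> 'rV[R]_n) (l : 'rV[R]_n) : w @ U --> l ->
      c * nsq (w k - l) @[k --> U] --> (0 : R).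
    by move=> /cvg_nsqP wl; rewrite -(mulr0 c); exact: cvgMl_tmp.
  have -> : (0 : R) = (2 * gamma * rho)^-1 * \sum_(e : edge adj) 0 + \sum_(i < N) (0 + 0).
    by rewrite addr0 !big1 // mulr0 addr0.
  apply: cvgD; last by apply: cvg_sumr => i _; apply: cvgD; exact: nsq_lim.
  by apply: cvgMl_tmp; apply: cvg_sumr => e _; apply/cvg_nsqP.
have lyap_oo : lyap Xs Ys Ls @ \oo --> (0 : R).
  (* Monotonicity gives a limit along [\oo]; the finer [U] has the same limit, which is 0. *)
  have lyap_cvg : cvgn (lyap Xs Ys Ls).
    apply: nonincreasing_is_cvgn; first exact: lyap_noninc.
    by exists 0 => _ [k _ <-]; have [] := lyap_bounds Xs Ys Ls k.
  by rewrite -(norm_cvg_unique (toU _ _ _ lyap_cvg) lyap_U).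
split=> // [i|i|e].
- apply: (dominated_cvg (tau_rho_gt0 i) _ lyap_oo) => k.
  by have [] := lyap_bounds Xs Ys Ls k.
- apply: (dominated_cvg (zeta_gt0 i) _ lyap_oo) => k.
  by have [] := lyap_bounds Xs Ys Ls k.
- apply: (dominated_cvg dual_gt0 _ lyap_oo) => k.
  by have [] := lyap_bounds Xs Ys Ls k.
Qed.

End Lyapunov.

(** * Optimality of KKT points *)

(** Convexity bounds each [F_i] below by its linearization at the KKT point. The [y]-gradient
    vanishes, and the [x]-gradients [A_i^T Ls] sum to the product of [Ls] with [A (X - Xs)], which
    is 0 for feasible [X]. *)
Lemma KKT_optimal (R : realType) (n N : nat) (adj : rel 'I_N)
    (f : 'I_N -> 'rV[R]_n * 'rV[R]_n -> R)
    (gc gh : 'I_N -> 'rV[R]_n * 'rV[R]_n -> 'rV[R]_n) (mu1 mu2 : R) Xs Ys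
    (Ls : edge adj -> 'rV[R]_n) :
  (forall i, jconvex (f i)) -> (forall i, has_gradient (f i) (gc i) (gh i)) ->
  0 <= mu1 -> 0 <= mu2 -> KKT gc gh mu1 mu2 Xs Ys Ls ->
  P1_optimal adj f mu1 mu2 Xs Ys.
Proof.
move=> f_conv f_grad mu1_ge0 mu2_ge0 [feas [KKTc KKTh]]; split=> // X Y X_feas.
have -> : Ftot f mu1 mu2 Xs Ys =
    \sum_i (Fi (f i) mu1 mu2 (Xs i) (Ys i) + dotv (AiT Ls i) (X i - Xs i)).
  rewrite big_split /= -(dotE_Aop Ls (fun i => X i - Xs i)) /dotE [X in _ + X]big1 ?addr0 // => e _.
  by rewrite AopB X_feas feas subrr dotv0.
apply: ler_sum => i _; rewrite /Fi.
have := convex_grad_le (f_grad i) (f_conv i) (Xs i, Ys i) (X i, Y i); rewrite /=.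
have -> : gh i (Xs i, Ys i) = - (mu2 *: Ys i) by apply/eqP; rewrite -addr_eq0 KKTh.
rewrite KKTc; move: (gc i _) => p.
have nsq_shift (x y : 'rV[R]_n) : nsq y = nsq x + 2 * dotv x (y - x) + nsq (y - x).
  by rewrite -nsqD subrKC.
rewrite (nsq_shift (Xs i) (X i)) (nsq_shift (Ys i) (Y i)).
move: (X i - Xs i) (Y i - Ys i) => u v.
have := mulr_ge0 mu1_ge0 (nsq_ge0 u); have := mulr_ge0 mu2_ge0 (nsq_ge0 v).
rewrite !dotvE; lra.
Qed.

(** * Reduction to nonnegative Lipschitz constants *)

Lemma lipschitz_grad_le (R : realType) n
    (gc gh : 'rV[R]_n * 'rV[R]_n -> 'rV[R]_n) (C C' : R) :
  C <= C' -> lipschitz_grad gc gh C -> lipschitz_grad gc gh C'.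
Proof.
move=> CC' lip z z'; apply: le_trans (lip z z') _.
by apply: ler_wpM2r; rewrite ?sqrtr_ge0.
Qed.

Unset Implicit Arguments.

Theorem theorem1 (R : realType) (n N : nat) (adj : rel 'I_N)
  (f : 'I_N -> 'rV[R]_n * 'rV[R]_n -> R)
  (gc gh : 'I_N -> 'rV[R]_n * 'rV[R]_n -> 'rV[R]_n) (C : 'I_N -> R)
  (mu1 mu2 m rho gamma : R) (tau zeta eps : 'I_N -> R)
  (Wc Wh : nat -> 'I_N -> 'rV[R]_n) (lam : nat -> edge adj -> 'rV[R]_n) :
  (2 <= N)%N -> symmetric adj -> irreflexive adj -> graph_connected adj ->
  (forall i, jconvex (f i)) ->
  (forall i, has_gradient (f i) (gc i) (gh i)) ->
  (forall i, lipschitz_grad (gc i) (gh i) (C i)) ->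
  0 <= mu1 -> 0 < mu2 -> 0 < m -> m <= mu2 ->
  0 < rho -> (forall i, 0 < tau i) -> (forall i, 0 < zeta i) ->
  (exists (Wcs Whs : 'I_N -> 'rV[R]_n) (lams : edge adj -> 'rV[R]_n),
      KKT gc gh mu1 mu2 Wcs Whs lams) ->
  0 < gamma < 2 ->
  (forall i, 0 < eps i < 1) ->
  (forall i, tau i > rho * (1 / eps i - 1) * deg R adj i) ->
  (forall i, zeta i > C i / m * (C i + m)) ->
  \sum_i eps i < 2 - gamma ->
  (forall k, alg_step f mu1 mu2 rho gamma tau zeta Wc Wh lam k) ->
  exists (Wcs Whs : 'I_N -> 'rV[R]_n) (lams : edge adj -> 'rV[R]_n),
    [/\ KKT gc gh mu1 mu2 Wcs Whs lams,
        P1_optimal adj f mu1 mu2 Wcs Whs,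
        (forall i, (fun k => Wc k i) @ \oo --> Wcs i),
        (forall i, (fun k => Wh k i) @ \oo --> Whs i) &
        (forall e, (fun k => lam k e) @ \oo --> lams e)].
Proof.
move=> _ adjC adjI _ f_conv f_grad f_lip mu1_ge0 mu2_gt0 m0 m_mu2 rho0 tau0 zeta0.
move=> [Xs0 [Ys0 [Ls0 kkt0]]] /andP[gamma0 _] eps01 tau_gap zeta_gap eps_gap step.
(* [C i < 0] is possible when [n = 0]. *)
pose C' i := Num.max (C i) 0.
have C'0 i : 0 <= C' i by rewrite /C' le_max lexx orbT.
have f_lip' i : lipschitz_grad (gc i) (gh i) (C' i).
  by apply: lipschitz_grad_le (f_lip i); rewrite /C' le_max lexx.
(* When [C i <= 0], [C' i] is 0 and the condition becomes [0 < zeta i]. *)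
have zeta_gap' i : C' i / m * (C' i + m) < zeta i.
  by rewrite /C'; case: (leP (C i) 0) => _; rewrite ?mul0r ?zeta0 ?zeta_gap.
have eps0 i : 0 < eps i by have /andP[] := eps01 i.
have [Xs [Ys [Ls [kkt Xlim Ylim Llim]]]] := iterates_cvg adjC adjI f_conv f_grad C'0 f_lip'
  mu1_ge0 m0 m_mu2 rho0 gamma0 eps0 step tau0 zeta0 tau_gap zeta_gap' eps_gap kkt0.
exists Xs, Ys, Ls; split=> //.
exact: KKT_optimal f_conv f_grad mu1_ge0 (ltW mu2_gt0) kkt.
Qed.
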